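(* Let $\kappa,c\in\mathbb{R}$ with $c\neq0$. Let $\mathcal{D}$ be the An-Nurowski $(2,3,5)$-distribution on the circle twistor bundle $M$, with local coordinates $(\theta,\phi,h,q,\psi)$, associated to the An-Nurowski surface $\Sigma$ with metric $\left(\frac{\kappa c^2-h^2}{2c^3}\right)^2dh^2+h^2dq^2$ rolling without slipping or twisting on the plane with metric $d\theta^2+d\phi^2$. Let $\mathfrak{g}_2\cong\mathfrak{aut}(\mathcal{D})$ be the split $\mathfrak{g}_2$ Lie algebra of vector fields bracket-generated by $S^1,S^2,S^3$ (given in the context), and let $\mathfrak{sl}_3\subset\mathfrak{g}_2$ be the subalgebra $\operatorname{span}_{\mathbb{R}}\{L^1,L^2,L^3,L^4,L^5,L^6,H_1,H_2\}$. Then the vector fields of the subalgebra $\mathfrak{sl}_3$ naturally project through $$\pi:M\to\mathbb{R}^2\times\mathbb{S}^1,\qquad (\theta,\phi,h,q,\psi)\mapsto\Big(\theta,\phi,0,-\frac{\kappa}{2c}\psi,\psi\Big)$$ onto $\mathbb{R}^2\times\mathbb{S}^1=\{q=-\frac{\kappa}{2c}\psi\}\cap\{h=0\}$, the submanifold of the configuration space without $\Sigma$.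
   Context: Setting: on the coordinate domain $h>0$, $h^2\neq\kappa c^2$, the distribution $\mathcal{D}$ is the rank 2 distribution annihilated by $$\omega_1=d\theta-\cos(\psi)\tfrac{\kappa c^2-h^2}{2c^3}dh-\sin(\psi)h\,dq,\quad \omega_2=d\phi+\sin(\psi)\tfrac{\kappa c^2-h^2}{2c^3}dh-\cos(\psi)h\,dq,\quad \omega_3=d\psi+\tfrac{2c^3}{\kappa c^2-h^2}dq.$$ $\mathfrak{aut}(\mathcal{D})$ is the Lie algebra of infinitesimal symmetries of $\mathcal{D}$; it is abstractly isomorphic to split $\mathfrak{g}_2$. Vector fields: introduce functions (local coordinates on $M$) $$\begin{aligned} c_1&=6c^3\theta-4h(2c^3q+\kappa c^2\psi)\sin(\psi)-h(3\kappa c^2-h^2)\cos(\psi),\\ c_2&=6c^3\phi-4h(2c^3q+\kappa c^2\psi)\cos(\psi)+h(3\kappa c^2-h^2)\sin(\psi),\\ c_3&=2c^3q+\kappa c^2\psi,\qquad c_4=-\sin(\psi)h,\qquad c_5=\cos(\psi)h, \end{aligned}$$ and vector fields $$Z^1=\partial_{c_3}+2c_5\partial_{c_2}-2c_4\partial_{c_1},\quad Z^2=\partial_{c_4}+4c_3\partial_{c_1}-2c_5\partial_{c_3},\quad Z^3=\partial_{c_5}+2c_4\partial_{c_3}-4c_3\partial_{c_2},$$ $$S^1=Z^2+c_5Z^1,\quad S^2=Z^3-c_4Z^1,\quad S^3=-c_1Z^2+c_2Z^3-(c_1c_5+c_2c_4+c_3^2)Z^1.$$ Set $$S^4=[S^1,S^2],\quad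 S^5=[S^2,S^3],\quad S^6=[S^3,S^1],$$ $$L^1=[S^1,S^4],\quad L^2=[S^2,S^4],\quad L^3=[S^2,S^5],\quad L^4=[S^3,S^5],\quad L^5=[S^3,S^6],\quad L^6=[S^1,S^6],$$ $$H_1=[S^2,S^6],\quad H_2=[S^4,S^3].$$ The 14 vector fields $S^1,\dots,S^6,L^1,\dots,L^6,H_1,H_2$ span over $\mathbb{R}$ a Lie algebra of vector fields isomorphic to split $\mathfrak{g}_2$; this is the Lie algebra bracket-generated by $S^1,S^2,S^3$. The span of $L^1,\dots,L^6,H_1,H_2$ is a subalgebra isomorphic to $\mathfrak{sl}(3,\mathbb{R})$. Meaning of ''naturally project onto $\mathbb{R}^2\times\mathbb{S}^1$'': each vector field $X$ in $\mathfrak{sl}_3$ is tangent to the hypersurface $\{c_3=0\}=\{q=-\frac{\kappa}{2c}\psi\}$; the restriction of $X$ to this hypersurface, written in the coordinates $(\theta,\phi,h,\psi)$, extends smoothly to $h=0$; and the extension is tangent to $\{h=0\}$. Restricting it to $h=0$ gives a vector field on $\mathbb{R}^2\times\mathbb{S}^1$ with coordinates $(\theta,\phi,\psi)$ ($\psi$ being the angular fibre coordinate), and the vector fields so obtained form the projected Lie algebra, defining a local action of $SL(3,\mathbb{R})$ on $\mathbb{R}^2\times\mathbb{S}^1$. *)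

(* Defs.v *)
From HB Require Import structures.
From mathcomp Require Import all_boot all_order all_algebra.
From mathcomp Require Import all_classical all_reals all_analysis.

Set Implicit Arguments.
Unset Strict Implicit.
Unset Printing Implicit Defensive.

Import Order.TTheory GRing.Theory Num.Theory.
Import numFieldNormedType.Exports.
Local Open Scope classical_set_scope.
Local Open Scope ring_scope.

Section VectorFields.
Context {R : realType}.

(* The n-th differentiability class. For f differentiable, being C^(n+1) amounts
   to all directional derivatives being C^n. *)
Fixpoint Ck {V W : normedModType R} (n : nat) (f : V -> W) : Prop :=
  if n is m.+1 then
    (forall x, differentiable f x) /\ forall v : V, Ck m (fun x => 'D_v f x)
  else continuous f.

Definition smooth {V W : normedModType R} (f : V -> W) := forall n, Ck n f.

(* A vector field on an open subset of V is a total function V -> V of which only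
   the values on that subset matter. As a derivation, X acts on f by
   p |-> 'D_(X p) f p, and [X, Y] = X Y - Y X. *)
Definition lie_bracket {V : normedModType R} (X Y : V -> V) : V -> V :=
  fun p => 'D_(X p) Y p - 'D_(Y p) X p.

(* G is a Lie algebra of vector fields on the open set U: the first condition
   says that membership depends only on the restriction to U. *)
Definition lie_algebra_on {V : normedModType R} (U : set V)
    (G : set (V -> V)) : Prop :=
  [/\ forall X Y, (forall p, U p -> X p = Y p) -> G X -> G Y,
      G (fun=> 0),
      forall (a : R) X Y, G X -> G Y -> G (fun p => a *: X p + Y p)
    & forall X Y, G X -> G Y -> G (lie_bracket X Y)].

Definition span_on {V : normedModType R} (U : set V) (s : seq (V -> V)) :
    set (V -> V) :=
  [set X | exists a : nat -> R, forall p, U p ->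
     X p = \sum_(i < size s) a i *: nth (fun=> 0) s i p].

(* k-th coordinate (from 0) of a row vector, and the row vector with the given
   list of coordinates *)
Definition coord {n : nat} (k : nat) (p : 'rV[R]_n.+1) : R := p ord0 (inord k).

Definition vec (n : nat) (s : seq R) : 'rV[R]_n := \row_(j < n) nth 0 s j.

End VectorFields.

Section AnNurowski.
Context {R : realType}.
Variables kappa c : R.

Local Notation M := 'rV[R]_5.

Definition theta (p : M) : R := coord 0 p.
Definition phi   (p : M) : R := coord 1 p.
Definition hh    (p : M) : R := coord 2 p.
Definition qq    (p : M) : R := coord 3 p.
Definition psi   (p : M) : R := coord 4 p.

(* The domain on which the forms omega_1, omega_2, omega_3 defining the
   An-Nurowski distribution make sense; psi is taken on the universal cover of
   the circle, as c_3 is not periodic in psi. *)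
Definition domM : set M := [set p | 0 < hh p /\ hh p ^+ 2 != kappa * c ^+ 2].

Definition c1 (p : M) : R :=
  6 * c ^+ 3 * theta p
  - 4 * hh p * (2 * c ^+ 3 * qq p + kappa * c ^+ 2 * psi p) * sin (psi p)
  - hh p * (3 * kappa * c ^+ 2 - hh p ^+ 2) * cos (psi p).
Definition c2 (p : M) : R :=
  6 * c ^+ 3 * phi p
  - 4 * hh p * (2 * c ^+ 3 * qq p + kappa * c ^+ 2 * psi p) * cos (psi p)
  + hh p * (3 * kappa * c ^+ 2 - hh p ^+ 2) * sin (psi p).
Definition c3 (p : M) : R := 2 * c ^+ 3 * qq p + kappa * c ^+ 2 * psi p.
Definition c4 (p : M) : R := - sin (psi p) * hh p.
Definition c5 (p : M) : R := cos (psi p) * hh p.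

Definition cmap (p : M) : M := vec 5 [:: c1 p; c2 p; c3 p; c4 p; c5 p].

(* The coordinate vector field of c_k, k = 1, ..., 5: the frame dual to
   dc_1, ..., dc_5. Since v *m jacobian f p is the derivative of f at p along the
   row vector v, it consists of the rows of the inverse Jacobian. *)
Definition dc (k : nat) (p : M) : M := row (inord k.-1) (invmx (jacobian cmap p)).

Definition Z1 (p : M) : M :=
  dc 3 p + (2 * c5 p) *: dc 2 p - (2 * c4 p) *: dc 1 p.
Definition Z2 (p : M) : M :=
  dc 4 p + (4 * c3 p) *: dc 1 p - (2 * c5 p) *: dc 3 p.
Definition Z3 (p : M) : M :=
  dc 5 p + (2 * c4 p) *: dc 3 p - (4 * c3 p) *: dc 2 p.

Definition S1 (p : M) : M := Z2 p + c5 p *: Z1 p.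
Definition S2 (p : M) : M := Z3 p - c4 p *: Z1 p.
Definition S3 (p : M) : M :=
  - c1 p *: Z2 p + c2 p *: Z3 p
  - (c1 p * c5 p + c2 p * c4 p + c3 p ^+ 2) *: Z1 p.

Definition S4 := lie_bracket S1 S2.
Definition S5 := lie_bracket S2 S3.
Definition S6 := lie_bracket S3 S1.

Definition L1 := lie_bracket S1 S4.
Definition L2 := lie_bracket S2 S4.
Definition L3 := lie_bracket S2 S5.
Definition L4 := lie_bracket S3 S5.
Definition L5 := lie_bracket S3 S6.
Definition L6 := lie_bracket S1 S6.

Definition H1 := lie_bracket S2 S6.
Definition H2 := lie_bracket S4 S3.

Definition g2 : set (M -> M) := smallest (lie_algebra_on domM) [set S1; S2; S3].

Definition sl3 : set (M -> M) :=
  span_on domM [:: L1; L2; L3; L4; L5; L6; H1; H2].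

Definition proj (p : M) : M :=
  vec 5 [:: theta p; phi p; 0; - (kappa / (2 * c)) * psi p; psi p].

(* The hypersurface {c3 = 0} in the coordinates (theta, phi, h, psi). *)
Definition hypersurface (y : 'rV[R]_4) : M :=
  vec 5 [:: coord 0 y; coord 1 y; coord 2 y;
            - (kappa / (2 * c)) * coord 3 y; coord 3 y].

(* {h = 0} in these coordinates, and R^2 x S^1 as the image of proj, both in the
   coordinates (theta, phi, psi). *)
Definition zero_section (z : 'rV[R]_3) : 'rV[R]_4 :=
  vec 4 [:: coord 0 z; coord 1 z; 0; coord 2 z].

Definition base (z : 'rV[R]_3) : M :=
  vec 5 [:: coord 0 z; coord 1 z; 0; - (kappa / (2 * c)) * coord 2 z; coord 2 z].

(* Vector fields on R^2 x S^1: smooth and 2 pi-periodic in psi. *)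
Definition field_R2S1 (W : 'rV[R]_3 -> 'rV[R]_3) : Prop :=
  smooth W /\
  forall t f s : R, W (vec 3 [:: t; f; s + 2 * pi]) = W (vec 3 [:: t; f; s]).

(* X projects to the vector field W on R^2 x S^1: X is tangent to {c3 = 0}; its
   restriction to {c3 = 0} has a smooth extension Y across h = 0; Y is tangent
   to {h = 0}; and the differential of proj maps Y on {h = 0} to W. *)
Definition projects_to (X : M -> M) (W : 'rV[R]_3 -> 'rV[R]_3) : Prop :=
  [/\ forall p, domM p -> c3 p = 0 -> 'D_(X p) c3 p = 0,
      field_R2S1 W
    & exists Y : 'rV[R]_4 -> 'rV[R]_4,
      [/\ smooth Y,
          forall y, domM (hypersurface y) ->
            'D_(Y y) hypersurface y = X (hypersurface y),
          forall y, coord 2 y = 0 -> coord 2 (Y y) = 0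
        & forall z, 'D_(W z) base z =
            'D_(Y (zero_section z)) (proj \o hypersurface) (zero_section z)]].

Definition projected_sl3 : set ('rV[R]_3 -> 'rV[R]_3) :=
  [set W | exists2 X, sl3 X & projects_to X W].

End AnNurowski.

(* G is the image of an infinitesimal action of SL(3, R), i.e. of a Lie algebra
   homomorphism from the traceless 3 x 3 matrices to vector fields on V. *)
Definition sl3_action_image {R : realType} {V : normedModType R}
    (G : set (V -> V)) : Prop :=
  exists rho : 'M[R]_3 -> V -> V,
    [/\ forall (a : R) (A B : 'M[R]_3), \tr A = 0 -> \tr B = 0 ->
          rho (a *: A + B) = (fun z => a *: rho A z + rho B z),
        forall A B : 'M[R]_3, \tr A = 0 -> \tr B = 0 ->
          rho (A *m B - B *m A) = lie_bracket (rho A) (rho B)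
      & G = [set rho A | A in [set A : 'M[R]_3 | \tr A = 0]]].

(* Main.v *)
(* In the coordinates c_1, ..., c_5 the fields S^i are polynomial, so are their
   brackets, and the span of L^1, ..., L^6, H_1, H_2 is the image of an explicit
   polynomial representation A |-> X_A of the traceless 3 x 3 matrices. Each X_A
   is tangent to {c_3 = 0}, where its c_1, c_2 components are those of the
   projective field of A on the plane and its c_4, c_5 components are linear in
   (c_4, c_5). As (c_4, c_5) = h (- sin psi, cos psi), passing to the polar
   coordinates h, psi gives a smooth field across h = 0, tangent to {h = 0}. The
   projected field is unique because points with h > 0 accumulate at h = 0.
   All functions involved are trigonometric polynomials, up to a factor 1 / h:
   they are represented by syntactic expressions, stable under derivation. *)
Require Import Defs.
From HB Require Import structures.
From mathcomp Require Import all_boot all_order all_algebra.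
From mathcomp Require Import all_classical all_reals all_analysis.
From mathcomp Require Import ring.
Import Order.TTheory GRing.Theory Num.Theory.
Import numFieldNormedType.Exports.
Local Open Scope classical_set_scope.
Local Open Scope ring_scope.

(** * Trigonometric polynomials as syntactic expressions, and their derivatives *)

Section Expressions.
Context {R : realType}.

Inductive expr (n : nat) : Type :=
  | Var of 'I_n
  | Cst of R
  | Opp of expr n
  | Add of expr n & expr n
  | Mul of expr n & expr n
  | Sin of expr n
  | Cos of expr n.

Arguments Var {n}.
Arguments Cst {n}.
Arguments Opp {n}.
Arguments Add {n}.
Arguments Mul {n}.
Arguments Sin {n}.
Arguments Cos {n}.

Fixpoint evalx {n} (e : expr n) (p : 'rV[R]_n) : R :=
  match e with
  | Var i => p ord0 i
  | Cst a => a
  | Opp e => - evalx e p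
  | Add e f => evalx e p + evalx f p
  | Mul e f => evalx e p * evalx f p
  | Sin e => sin (evalx e p)
  | Cos e => cos (evalx e p)
  end.

(* The derivation of the algebra of expressions mapping the i-th variable to
   [X i]. *)
Fixpoint der {n} (X : 'I_n -> expr n) (e : expr n) : expr n :=
  match e with
  | Var i => X i
  | Cst _ => Cst 0
  | Opp e => Opp (der X e)
  | Add e f => Add (der X e) (der X f)
  | Mul e f => Add (Mul (der X e) f) (Mul e (der X f))
  | Sin e => Mul (Cos e) (der X e)
  | Cos e => Opp (Mul (Sin e) (der X e))
  end.

Definition evalv {n m} (X : 'I_m -> expr n) (p : 'rV[R]_n) : 'rV[R]_m :=
  \row_j evalx (X j) p.

(** A constant field, so that [der (cstv v)] is the directional derivative along [v]. *)
Definition cstv {n} (v : 'rV[R]_n) (i : 'I_n) : expr n := Cst (v ord0 i).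

Lemma is_derive_comp1 {V : normedModType R} (g : R -> R) (f : V -> R) x v dg df :
  is_derive (f x) 1 g dg -> is_derive x v f df -> differentiable f x ->
  is_derive x v (g \o f) (dg * df).
Proof.
move=> [gd <-] [fd <-] fdi; have gdi : differentiable g (f x).
  exact/derivable1_diffP.
have cdi : differentiable (g \o f) x by exact: differentiable_comp.
apply: DeriveDef; first exact: diff_derivable.
rewrite !deriveE// diff_comp//= mulrC -[X in 'd g _ X]mulr1.
by rewrite [LHS]linearZ.
Qed.

Lemma differentiable_eval {n} (e : expr n) p : differentiable (evalx e) p.
Proof.
elim: e => [i|a|e IH|e IHe f IHf|e IHe f IHf|e IH|e IH] /=.
- exact: differentiable_coord.
- exact: differentiable_cst.
- exact: differentiableN.
- exact: differentiableD.
- exact: differentiableM.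
- apply: (differentiable_comp (f := evalx e) (g := sin)) => //.
  exact/derivable1_diffP/derivable_sin.
- apply: (differentiable_comp (f := evalx e) (g := cos)) => //.
  exact/derivable1_diffP/derivable_cos.
Qed.

Lemma is_derive_coord {V : normedModType R} {n} (Y : V -> 'rV[R]_n) p v
    (Y' : 'rV[R]_n) i :
  is_derive p v Y Y' -> is_derive p v (fun q => Y q ord0 i) (Y' ord0 i).
Proof.
move=> [Yd <-]; apply: DeriveDef; first by move/derivable_mxP: Yd; exact.
by rewrite derive_mx// mxE.
Qed.

Lemma is_derive_row {V : normedModType R} {n} (Y : V -> 'rV[R]_n) p v
    (Y' : 'rV[R]_n) :
  (forall i, is_derive p v (fun q => Y q ord0 i) (Y' ord0 i)) ->
  is_derive p v Y Y'.
Proof.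
move=> Yd; have Yd' : derivable Y p v.
  by apply/derivable_mxP => i j; rewrite ord1; case: (Yd j).
apply: DeriveDef => //; rewrite derive_mx//.
by apply/rowP => j; rewrite mxE; case: (Yd j).
Qed.

Lemma is_derive_eval {n} (e : expr n) p v :
  is_derive p v (evalx e) (evalx (der (cstv v) e) p).
Proof.
elim: e => [i|a|e IH|e IHe f IHf|e IHe f IHf|e IH|e IH] /=.
- exact: (is_derive_coord id).
- exact: is_derive_cst.
- exact: is_deriveN.
- exact: is_deriveD.
- apply: (is_derive_eq (is_deriveM IHe IHf)).
  by rewrite addrC /GRing.scale/= [X in X + _]mulrC.
- apply: is_derive_comp1 => //; exact: differentiable_eval.
- rewrite -mulNr; apply: is_derive_comp1 => //; exact: differentiable_eval.
Qed.

Lemma derive_eval {n} (e : expr n) p v :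
  'D_v (evalx e) p = evalx (der (cstv v) e) p.
Proof. exact/derive_val/is_derive_eval. Qed.

Lemma differentiable_evalv {n m} (X : 'I_m -> expr n) p :
  differentiable (evalv X) p.
Proof.
have -> : evalv X = \sum_j (fun p => evalx (X j) p *: delta_mx ord0 j).
  apply/funext => q; rewrite fct_sumE [LHS]row_sum_delta.
  by apply: eq_bigr => j _; rewrite mxE.
apply: differentiable_sum => j.
exact/differentiableZl/differentiable_eval.
Qed.

Lemma is_derive_evalv {n m} (X : 'I_m -> expr n) p v :
  is_derive p v (evalv X) (evalv (fun j => der (cstv v) (X j)) p).
Proof.
apply: is_derive_row => i; rewrite mxE.
rewrite (_ : (fun q => _) = evalx (X i)); first exact: is_derive_eval.
by apply/funext => q; rewrite mxE.
Qed.

Lemma derive_evalv {n m} (X : 'I_m -> expr n) p v :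
  'D_v (evalv X) p = evalv (fun j => der (cstv v) (X j)) p.
Proof. exact/derive_val/is_derive_evalv. Qed.

(** Directional derivatives of expressions are again expressions, so the induction on the order
    closes. *)
Lemma smooth_evalv {n m} (X : 'I_m -> expr n) : smooth (evalv X).
Proof.
move=> k; elim: k X => [|k IH] X /=.
  by move=> p; exact/differentiable_continuous/differentiable_evalv.
split=> [p|v]; first exact: differentiable_evalv.
by rewrite (_ : (fun x => _) = evalv (fun j => der (cstv v) (X j)));
  [exact: IH | apply/funext => p; rewrite derive_evalv].
Qed.

(** A derivation at [p] depends only on the value of the field at [p], so its components may be
    frozen there. *)
Lemma der_evalv {n} (X : 'I_n -> expr n) (e : expr n) p :
  evalx (der (cstv (evalv X p)) e) p = evalx (der X e) p.
Proof. by elim: e => //= *; rewrite ?mxE//; congruence. Qed.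

(** Symmetry of second derivatives, by structural induction. It makes the second-order terms of a
    bracket cancel. *)
Lemma der_comm {n} (v w : 'rV[R]_n) (e : expr n) p :
  evalx (der (cstv v) (der (cstv w) e)) p = evalx (der (cstv w) (der (cstv v) e)) p.
Proof.
by elim: e => //= [e ->|e -> f ->|e IHe f IHf|e IH|e IH] //;
  rewrite ?IHe ?IHf ?IH; ring.
Qed.

Lemma derB {n} (v w : 'rV[R]_n) (e : expr n) p :
  evalx (der (cstv (v - w)) e) p =
  evalx (der (cstv v) e) p - evalx (der (cstv w) e) p.
Proof.
elim: e => [i|a|e IH|e IHe f IHf|e IHe f IHf|e IH|e IH] /=;
  rewrite ?mxE ?IH ?IHe ?IHf; ring.
Qed.

(** Both the direction and the point vary, whence two terms. [Y] is arbitrary because the fields to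
    be treated involve 1 / h and are not expressions. *)
Lemma is_derive_der {n} (Y : 'rV[R]_n -> 'rV[R]_n) p v
    (Y' : 'rV[R]_n) (e : expr n) :
  is_derive p v Y Y' ->
  is_derive p v (fun q => evalx (der (cstv (Y q)) e) q)
    (evalx (der (cstv Y') e) p + evalx (der (cstv v) (der (cstv (Y p)) e)) p).
Proof.
move=> dY.
elim: e => [i|a|e IH|e IHe f IHf|e IHe f IHf|e IH|e IH] /=.
- by rewrite addr0; apply: is_derive_coord.
- by rewrite addr0; apply: is_derive_cst.
- by rewrite -opprD; apply: is_deriveN.
- by apply: (is_derive_eq (is_deriveD IHe IHf)); ring.
- have de := is_derive_eval e p v; have df := is_derive_eval f p v.
  apply: (is_derive_eq (is_deriveD (is_deriveM IHe df) (is_deriveM de IHf))).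
  by rewrite /GRing.scale/=; ring.
- apply: (is_derive_eq (is_deriveM (is_derive_eval (Cos e) p v) IH)).
  by rewrite /GRing.scale/=; ring.
- apply: (is_derive_eq
    (is_deriveN (is_deriveM (is_derive_eval (Sin e) p v) IH))).
  by rewrite /GRing.scale/=; ring.
Qed.

Definition brk {n} (X Y : 'I_n -> expr n) (j : 'I_n) : expr n :=
  Add (der X (Y j)) (Opp (der Y (X j))).

Lemma lie_bracket_evalv {n} (X Y : 'I_n.+1 -> expr n.+1) :
  lie_bracket (evalv X) (evalv Y) = evalv (brk X Y).
Proof.
apply/funext => p; rewrite /lie_bracket !derive_evalv.
by apply/rowP => j; rewrite !mxE !der_evalv.
Qed.

End Expressions.

(* Notation for expressions, small index sets and a trigonometric criterion *)
Declare Scope expr_scope.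
Delimit Scope expr_scope with X.
Bind Scope expr_scope with expr.

Arguments Var {R n}.
Arguments Cst {R n} _%_R.
Arguments Opp {R n}.
Arguments Add {R n}.
Arguments Mul {R n}.
Arguments Sin {R n} _%_X.
Arguments Cos {R n} _%_X.

Local Notation "- a" := (Opp a) : expr_scope.
Local Notation "a + b" := (Add a b) : expr_scope.
Local Notation "a - b" := (Add a (Opp b)) : expr_scope.
Local Notation "a * b" := (Mul a b) : expr_scope.
Local Notation o_ n k := (@Ordinal n k isT).
Local Notation x_ k := (Var (o_ 5 k)).

Definition fld {R : realType} {n m} (s : seq (expr (R := R) n))
    (j : 'I_m) : expr n :=
  nth (Cst 0) s j.

(** The indices carry the proof [isT], so that components given by lists compute. *)
Lemma ord3P (Q : 'I_3 -> Type) :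
  Q (o_ 3 0) -> Q (o_ 3 1) -> Q (o_ 3 2) -> forall j, Q j.
Proof.
move=> q0 q1 q2 [[|[|[|//]]] hj]; by rewrite (bool_irrelevance hj isT).
Qed.

Lemma ord4P (Q : 'I_4 -> Type) :
  Q (o_ 4 0) -> Q (o_ 4 1) -> Q (o_ 4 2) -> Q (o_ 4 3) -> forall j, Q j.
Proof.
move=> q0 q1 q2 q3 [[|[|[|[|//]]]] hj]; by rewrite (bool_irrelevance hj isT).
Qed.

Lemma ord5P (Q : 'I_5 -> Type) :
  Q (o_ 5 0) -> Q (o_ 5 1) -> Q (o_ 5 2) -> Q (o_ 5 3) -> Q (o_ 5 4) ->
  forall j, Q j.
Proof.
move=> q0 q1 q2 q3 q4 [[|[|[|[|[|//]]]]] hj];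
  by rewrite (bool_irrelevance hj isT).
Qed.

Lemma sum_ord3 {V : nmodType} (F : 'I_3 -> V) :
  \sum_i F i = F (o_ 3 0) + F (o_ 3 1) + F (o_ 3 2).
Proof.
by rewrite !big_ord_recl big_ord0 addr0 -!addrA;
  do ![congr (_ + _)]; congr F; apply: val_inj.
Qed.

Lemma sum_ord5 {V : nmodType} (F : 'I_5 -> V) :
  \sum_i F i = F (o_ 5 0) + F (o_ 5 1) + F (o_ 5 2) + F (o_ 5 3) + F (o_ 5 4).
Proof.
by rewrite !big_ord_recl big_ord0 addr0 -!addrA;
  do ![congr (_ + _)]; congr F; apply: val_inj.
Qed.

Lemma coordE {R : realType} {n k} (h : (k < n.+1)%N) (p : 'rV[R]_n.+1) :
  Defs.coord k p = p ord0 (Ordinal h).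
Proof. by rewrite /Defs.coord; congr (p _ _); apply: val_inj; rewrite /= inordK. Qed.

(** An identity modulo cos^2 + sin^2 = 1 is certified by its cofactor [d]; what remains holds with
    sin and cos as independent symbols. *)
Lemma trig_eq {R : realType} (a : R) (d x y : R) :
  x - y = (cos a ^+ 2 + sin a ^+ 2 - 1) * d -> x = y.
Proof. by rewrite cos2Dsin2 subrr mul0r => /eqP; rewrite subr_eq0 => /eqP. Qed.

(** * The coordinate frame of c_1, ..., c_5 and the pullback of polynomial fields *)

Section Frame.
Context {R : realType}.
Variables (kappa c : R).
Hypothesis hc : c != 0.
Local Notation cmap := (cmap kappa c).

Definition cmapX : 'I_5 -> expr (R := R) 5 :=
  let th := x_ 0 in let ph := x_ 1 in let h := x_ 2 in let q := x_ 3 in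
  let ps := x_ 4 in
  let y3 := (Cst (2 * c ^+ 3) * q + Cst (kappa * c ^+ 2) * ps)%X in
  let g := (h * (Cst (3 * kappa * c ^+ 2) - h * h))%X in
  fld [:: Cst (6 * c ^+ 3) * th - Cst 4 * h * y3 * Sin ps - g * Cos ps;
          Cst (6 * c ^+ 3) * ph - Cst 4 * h * y3 * Cos ps + g * Sin ps;
          y3; - Sin ps * h; Cos ps * h]%X.

Lemma cmapE : cmap = evalv cmapX.
Proof.
apply/funext => p; apply/rowP; apply: ord5P; rewrite !mxE /= /c1 /c2 /c4 /c5 /c3
  /theta /phi /hh /qq /psi ?(coordE (isT : 0 < 5)%N) ?(coordE (isT : 1 < 5)%N)
  ?(coordE (isT : 2 < 5)%N) ?(coordE (isT : 3 < 5)%N) ?(coordE (isT : 4 < 5)%N);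
  ring.
Qed.

(* The i-th row is [h] times the coordinate field of c_(i+1). *)
Definition frameX (i : 'I_5) : 'I_5 -> expr (R := R) 5 :=
  let h := x_ 2 in let s := Sin (x_ 4) in let k := Cos (x_ 4) in
  let y3 := (Cst (2 * c ^+ 3) * x_ 3 + Cst (kappa * c ^+ 2) * x_ 4)%X in
  let g := (Cst (3 * kappa * c ^+ 2) - h * h)%X in
  let u := Cst (6 * c ^+ 3)^-1 in
  let w := Cst (kappa * c ^+ 2 / (2 * c ^+ 3)) in
  fld (nth [::]
   [:: [:: u * h];
       [:: Cst 0; u * h];
       [:: u * (Cst 4 * h * h * s); u * (Cst 4 * h * h * k); Cst 0;
           Cst (2 * c ^+ 3)^-1 * h];
       [:: u * h * (Cst 2 * h * h * s * k - Cst 4 * y3);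
           u * h * (g - Cst 2 * h * h * s * s); - h * s; w * k; - k];
       [:: u * h * (g - Cst 2 * h * h * k * k);
           u * h * (Cst 4 * y3 + Cst 2 * h * h * s * k); h * k; w * s; - s]]%X i).

Definition frame (i : 'I_5) (p : 'rV[R]_5) : 'rV[R]_5 :=
  (hh p)^-1 *: evalv (frameX i) p.

Lemma hhE (p : 'rV[R]_5) : hh p = p ord0 (o_ 5 2).
Proof. exact: coordE. Qed.

Lemma derive_cmap_frame i p : hh p != 0 ->
  'D_(frame i p) cmap p = delta_mx ord0 i.
Proof.
rewrite hhE => hp.
have hy : hh p = p ord0 (o_ 5 2) := hhE p.
have c3n : 6 * c ^+ 3 != 0 :> R by rewrite mulf_neq0 ?expf_neq0 ?pnatr_eq0.
rewrite cmapE derive_evalv; apply/rowP; move: i.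
apply: ord5P; apply: ord5P; rewrite !mxE /= !mxE /= hy.
all: try by field; rewrite ?hc ?hp.
(* Left are the c_1, c_2 and diagonal entries for the coordinate fields of c_4 and c_5: they rest on
   cos^2 + sin^2 = 1, with the cofactors given below. *)
all: set a := p ord0 (o_ 5 4).
all: set h := p ord0 (o_ 5 2).
all: set y3 := 2 * c ^+ 3 * p ord0 (o_ 5 3) + kappa * c ^+ 2 * a.
all: pose g := 3 * kappa * c ^+ 2 - h * h.
- by apply: (@trig_eq _ a (4 * y3)); rewrite /y3; field; rewrite ?hc ?hp.
- by apply: (@trig_eq _ a (- g)); rewrite /g; field; rewrite ?hc ?hp.
- by apply: (@trig_eq _ a 1); field; rewrite ?hc ?hp.
- by apply: (@trig_eq _ a (- g)); rewrite /g; field; rewrite ?hc ?hp.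
- by apply: (@trig_eq _ a (- 4 * y3)); rewrite /y3; field; rewrite ?hc ?hp.
- by apply: (@trig_eq _ a 1); field; rewrite ?hc ?hp.
Qed.

Lemma cmap_differentiable p : differentiable cmap p.
Proof. rewrite cmapE; exact: differentiable_evalv. Qed.

Lemma frame_jacobian p : hh p != 0 ->
  (\matrix_i frame i p) *m jacobian cmap p = 1%:M.
Proof.
move=> hp; apply/row_matrixP => i.
rewrite row_mul rowK -deriveEjacobian ?derive_cmap_frame//; last first.
  exact: cmap_differentiable.
by rewrite row1.
Qed.

(** A one-sided inverse of a square matrix is two-sided, so the inverse Jacobian is checked rather
    than computed. *)
Lemma invmx_jacobian p : hh p != 0 ->
  invmx (jacobian cmap p) = \matrix_i frame i p.
Proof.
move=> /frame_jacobian KJ; have [Ku Ju] := mulmx1_unit KJ.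
by rewrite -[LHS]mul1mx -KJ mulmxK.
Qed.

(** Tangent vectors can thus be compared through their components in c_1, ..., c_5. *)
Lemma derive_cmap_inj p v w : hh p != 0 ->
  'D_v cmap p = 'D_w cmap p -> v = w.
Proof.
move=> /frame_jacobian KJ; have [Ku Ju] := mulmx1_unit KJ.
by rewrite !deriveEjacobian; [exact: can_inj (mulmxK Ju) _ _
  |exact: cmap_differentiable..].
Qed.

Lemma dcE k (hk : (k < 5)%N) p : hh p != 0 ->
  dc kappa c k.+1 p = frame (Ordinal hk) p.
Proof.
move=> hp; rewrite /dc invmx_jacobian// rowK; congr frame.
by apply: val_inj; rewrite /= inordK.
Qed.

(* The vector field with components [P] in the coordinates c_1, ..., c_5. *)
Definition pull (P : 'I_5 -> expr (R := R) 5) (p : 'rV[R]_5) : 'rV[R]_5 :=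
  \sum_i evalx (P i) (cmap p) *: frame i p.

Lemma derive_cmap_pull P p : hh p != 0 ->
  'D_(pull P p) cmap p = evalv P (cmap p).
Proof.
move=> hp; rewrite deriveEjacobian; last exact: cmap_differentiable.
rewrite /pull mulmx_suml [RHS]row_sum_delta; apply: eq_bigr => i _.
rewrite -scalemxAl -deriveEjacobian ?derive_cmap_frame ?mxE//.
exact: cmap_differentiable.
Qed.

Lemma pull_ext P Q p : (forall x i, evalx (P i) x = evalx (Q i) x) ->
  pull P p = pull Q p.
Proof. by move=> PQ; apply: eq_bigr => i _; rewrite PQ. Qed.

Lemma hh_differentiable (p : 'rV[R]_5) : differentiable (@hh R) p.
Proof.
rewrite (_ : @hh R = (fun p : 'rV[R]_5 => p ord0 (o_ 5 2))); last first.
  by apply/funext => q; exact: hhE.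
exact: differentiable_coord.
Qed.

Lemma near_hh_neq0 (p : 'rV[R]_5) : hh p != 0 -> \forall q \near p, hh q != 0.
Proof.
move=> hp.
have ch := differentiable_continuous (hh_differentiable p).
exact: cvgr_neq0 ch hp.
Qed.

Lemma derivable_pull P p v : hh p != 0 -> derivable (pull P) p v.
Proof.
move=> hp; have dh : differentiable (@hh R) p by exact: hh_differentiable.
apply/derivable_mxP => i j; apply: diff_derivable.
have -> : (fun q => pull P q i j) = \sum_k
    (((evalx (P k) \o cmap) * (fun q => (hh q)^-1)) * evalx (frameX k j)).
  apply/funext => q; rewrite /pull summxE fct_sumE; apply: eq_bigr => k _.
  by rewrite ord1 /frame !mxE/= mulrA.
apply: differentiable_sum => k; apply: differentiableM; last first.
  exact: differentiable_eval.
apply: differentiableM; last exact: differentiableV.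
apply: differentiable_comp; first exact: cmap_differentiable.
exact: differentiable_eval.
Qed.

(** Naturality of the bracket under the local diffeomorphism [cmap]. Both sides are compared after
    applying its differential, where the second derivatives of [cmap] cancel by symmetry. *)
Lemma lie_bracket_pull P Q p : hh p != 0 ->
  lie_bracket (pull P) (pull Q) p = pull (brk P Q) p.
Proof.
move=> hp; apply: (derive_cmap_inj _ _ _ hp); rewrite derive_cmap_pull//.
(* The j-th component of [Y] composed with [cmap] is differentiated along [pull X] in two ways:
   through the components of [pull Y], and by the chain rule. *)
have key X Y j : evalx (der (cstv ('D_(pull X p) (pull Y) p)) (cmapX j)) p +
   evalx (der (cstv (pull X p)) (der (cstv (pull Y p)) (cmapX j))) p =
   evalx (der X (Y j)) (cmap p).
  have dY : is_derive p (pull X p) (pull Y) ('D_(pull X p) (pull Y) p).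
    exact/derivableP/derivable_pull.
  have [_ <-] := is_derive_der _ _ _ _ (cmapX j) dY.
  have -> : 'D_(pull X p) (fun q => evalx (der (cstv (pull Y q)) (cmapX j)) q) p =
            'D_(pull X p) (evalx (Y j) \o cmap) p.
    (* The two functions agree where h is nonzero, hence near [p]. *)
    apply: near_eq_derive; near=> q.
    have hq : hh q != 0 by near: q; exact: near_hh_neq0.
    have := derive_cmap_pull Y q hq.
    by rewrite {1}cmapE derive_evalv => /rowP/(_ j); rewrite !mxE.
  have dc : differentiable cmap p by exact: cmap_differentiable.
  have de : differentiable (evalx (Y j)) (cmap p) by exact: differentiable_eval.
  rewrite deriveE; last exact: differentiable_comp.
  rewrite diff_comp//= -deriveE// -deriveE// derive_cmap_pull//.
  by rewrite derive_eval der_evalv.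
rewrite /lie_bracket [in LHS]cmapE derive_evalv; apply/rowP => j.
rewrite !mxE derB /= -!key [in X in _ = _ + X]/= der_comm; ring.
Unshelve. all: by end_near. Qed.

End Frame.

(** * Polynomial form of the generators, and the representation of traceless matrices *)

Section Fields.
Context {R : realType}.
Variables (kappa c : R).
Hypothesis hc : c != 0.
Local Notation domM := (domM kappa c).
Local Notation pull := (pull kappa c).
Implicit Types (A B : 'M[R]_3) (F G : 'rV[R]_5 -> 'rV[R]_5).
Implicit Types (P Q N : 'I_5 -> expr (R := R) 5).

Lemma domM_hh_neq0 p : domM p -> hh p != 0.
Proof. by case=> /lt0r_neq0. Qed.

(** Openness of the domain: a bracket at a point involves the fields nearby. *)
Lemma near_domM p : domM p -> \forall q \near p, domM q.
Proof.
move=> [h0 h1].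
have ch := differentiable_continuous (hh_differentiable p).
have ck : {for p, continuous (fun q : 'rV[R]_5 => hh q ^+ 2 - kappa * c ^+ 2)}.
  apply: differentiable_continuous; apply: differentiableB => //.
  apply: (@differentiableX _ _ (@hh R) 1 p).
  exact: hh_differentiable.
have nk : \forall q \near p, hh q ^+ 2 - kappa * c ^+ 2 != 0.
  by apply: cvgr_neq0 ck _; rewrite subr_eq0.
have nh : \forall q \near p, 0 < hh q by apply: cvgr_gt ch _ h0.
near=> q; split; first by near: q.
by rewrite -subr_eq0; near: q.
Unshelve. all: by end_near. Qed.

Definition pulled F P := forall p, domM p -> F p = pull P p.

(** [N] is a simplified form of the bracket, which keeps the components of iterated brackets
    small. *)
Lemma pulled_lie_bracket F G P Q N : pulled F P -> pulled G Q ->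
  (forall x i, evalx (brk P Q i) x = evalx (N i) x) ->
  pulled (lie_bracket F G) N.
Proof.
move=> FP GQ eN p dp; have hp := domM_hh_neq0 _ dp.
rewrite -(pull_ext _ _ _ _ _ eN) -(lie_bracket_pull _ _ hc _ _ _ hp).
rewrite /lie_bracket (FP _ dp) (GQ _ dp); congr (_ - _); apply: near_eq_derive.
- by near=> q; apply: GQ; near: q; exact: near_domM.
- by near=> q; apply: FP; near: q; exact: near_domM.
Unshelve. all: by end_near. Qed.

(** Components of S^1, ..., S^6 along the coordinate fields of c_1, ..., c_5, with [x_ k] standing
    for c_(k+1); those of S^4, S^5, S^6 are simplified brackets. *)
Definition S1X := fld (m := 5) (R := R)
  [:: Cst 4 * x_ 2 - Cst 2 * x_ 3 * x_ 4; Cst 2 * x_ 4 * x_ 4; - x_ 4; Cst 1; Cst 0]%X.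
Definition S2X := fld (m := 5) (R := R)
  [:: Cst 2 * x_ 3 * x_ 3; - (Cst 2 * x_ 3 * x_ 4) - Cst 4 * x_ 2; x_ 3; Cst 0; Cst 1]%X.
Definition S3X := fld (m := 5) (R := R)
  [:: Cst 2 * x_ 2 * x_ 2 * x_ 3 + Cst 2 * x_ 1 * x_ 3 * x_ 3
        + Cst 2 * x_ 0 * x_ 3 * x_ 4 - Cst 4 * x_ 0 * x_ 2;
      - (Cst 2 * x_ 2 * x_ 2 * x_ 4) - Cst 2 * x_ 1 * x_ 3 * x_ 4
        - Cst 4 * x_ 1 * x_ 2 - Cst 2 * x_ 0 * x_ 4 * x_ 4;
      x_ 1 * x_ 3 + x_ 0 * x_ 4 - x_ 2 * x_ 2; - x_ 0; x_ 1]%X.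
Definition S4X := fld (m := 5) (R := R)
  [:: Cst 2 * x_ 3; - (Cst 2 * x_ 4); Cst 2; Cst 0; Cst 0]%X.
Definition S5X := fld (m := 5) (R := R)
  [:: Cst 2 * x_ 0 * x_ 3 - Cst 12 * x_ 2 * x_ 3 * x_ 3;
      Cst 12 * x_ 2 * x_ 3 * x_ 4 + Cst 10 * x_ 2 * x_ 2 - Cst 2 * x_ 0 * x_ 4;
      Cst 2 * x_ 0 - Cst 6 * x_ 2 * x_ 3; - (Cst 2 * x_ 3 * x_ 3);
      - (Cst 2 * x_ 3 * x_ 4) - Cst 4 * x_ 2]%X.
Definition S6X := fld (m := 5) (R := R)
  [:: Cst 10 * x_ 2 * x_ 2 - Cst 12 * x_ 2 * x_ 3 * x_ 4 - Cst 2 * x_ 1 * x_ 3;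
      Cst 12 * x_ 2 * x_ 4 * x_ 4 + Cst 2 * x_ 1 * x_ 4;
      - (Cst 6 * x_ 2 * x_ 4) - Cst 2 * x_ 1; Cst 4 * x_ 2 - Cst 2 * x_ 3 * x_ 4;
      - (Cst 2 * x_ 4 * x_ 4)]%X.

(* In the coordinates c_1, ..., c_5, the field of a traceless [A]. On
   [c_3 = 0] its c_1, c_2 components are the projective field induced on the
   affine chart [(c_1, c_2, 1)] by the right action of [A] on row vectors. *)
Definition sl3X A : 'I_5 -> expr (R := R) 5 :=
  let a i j := Cst (A i j) in
  let a00 := a (o_ 3 0) (o_ 3 0) in let a01 := a (o_ 3 0) (o_ 3 1) in
  let a02 := a (o_ 3 0) (o_ 3 2) in let a10 := a (o_ 3 1) (o_ 3 0) in
  let a11 := a (o_ 3 1) (o_ 3 1) in let a12 := a (o_ 3 1) (o_ 3 2) in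
  let a20 := a (o_ 3 2) (o_ 3 0) in let a21 := a (o_ 3 2) (o_ 3 1) in
  let a22 := a (o_ 3 2) (o_ 3 2) in
  let x1 := x_ 0 in let x2 := x_ 1 in let x3 := x_ 2 in let x4 := x_ 3 in
  let x5 := x_ 4 in
  fld
  [:: a20 + (a00 - a22) * x1 + a10 * x2
      + a02 * (Cst 4 * x3 * x3 * x4 * x4 - x1 * x1)
      + a12 * (Cst 2 * x3 * x3 * x3 - Cst 4 * x3 * x3 * x4 * x5 - x1 * x2);
      a21 + a01 * x1 + (a11 - a22) * x2
      - a02 * (Cst 4 * x3 * x3 * x4 * x5 + Cst 2 * x3 * x3 * x3 + x1 * x2)
      + a12 * (Cst 4 * x3 * x3 * x5 * x5 - x2 * x2);
      a02 * (Cst 2 * x3 * x3 * x4 - x1 * x3) - a22 * x3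
      - a12 * (Cst 2 * x3 * x3 * x5 + x2 * x3);
      a00 * x4 - a10 * x5 + a02 * (Cst 2 * x3 * x4 * x4 - x1 * x4)
      + a12 * (x3 * x3 - Cst 2 * x3 * x4 * x5 + x1 * x5);
      a11 * x5 - a01 * x4 + a02 * (Cst 2 * x3 * x4 * x5 + x3 * x3 + x2 * x4)
      - a12 * (Cst 2 * x3 * x5 * x5 + x2 * x5)]%X.

Definition mx3 (s : seq (seq R)) : 'M[R]_3 :=
  \matrix_(i, j) nth 0 (nth [::] s i) j.

Lemma sl3X_linear (a : R) A B x i :
  evalx (sl3X (a *: A + B) i) x = a * evalx (sl3X A i) x + evalx (sl3X B i) x.
Proof. move: i; apply: ord5P; rewrite /= !mxE; ring. Qed.

Lemma pull_sl3X_linear (a : R) A B p :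
  pull (sl3X (a *: A + B)) p = a *: pull (sl3X A) p + pull (sl3X B) p.
Proof.
rewrite /pull scaler_sumr -big_split; apply: eq_bigr => i _.
by rewrite sl3X_linear scalerDl scalerA.
Qed.

(** Eliminating one diagonal entry turns the trace condition into a substitution, after which [ring]
    applies. *)
Lemma trace0E A : \tr A = 0 ->
  A (o_ 3 2) (o_ 3 2) = - A (o_ 3 0) (o_ 3 0) - A (o_ 3 1) (o_ 3 1).
Proof.
by rewrite /mxtrace sum_ord3 => /eqP; rewrite addrC addr_eq0 opprD => /eqP.
Qed.

(** No sign appears, as for linear fields v |-> v A on row vectors, whose bracket is v (A B - B A).
    In the five coordinates it is a polynomial identity. *)
Lemma brk_sl3X A B x i : \tr A = 0 -> \tr B = 0 ->
  evalx (brk (sl3X A) (sl3X B) i) x = evalx (sl3X (A *m B - B *m A) i) x.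
Proof.
move=> /trace0E tA /trace0E tB; move: i.
apply: ord5P; rewrite /= !mxE !sum_ord3 tA tB; ring.
Qed.


Local Ltac pull_frame :=
  rewrite !(dcE kappa c hc 0 isT)// !(dcE kappa c hc 1 isT)//
    !(dcE kappa c hc 2 isT)// ?(dcE kappa c hc 3 isT)//
    ?(dcE kappa c hc 4 isT)//;
  rewrite /pull sum_ord5 /= !mxE /=; apply/rowP => j; rewrite !mxE; ring.

Lemma pulled_S1 : pulled (S1 kappa c) S1X.
Proof.
move=> p /domM_hh_neq0 hp; rewrite /S1 /Z1 /Z2 /Z3.
pull_frame.
Qed.

Lemma pulled_S2 : pulled (S2 kappa c) S2X.
Proof.
move=> p /domM_hh_neq0 hp; rewrite /S2 /Z1 /Z2 /Z3.
pull_frame.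
Qed.

Lemma pulled_S3 : pulled (S3 kappa c) S3X.
Proof.
move=> p /domM_hh_neq0 hp; rewrite /S3 /Z1 /Z2 /Z3.
pull_frame.
Qed.

Lemma pulled_S4 : pulled (S4 kappa c) S4X.
Proof.
apply: pulled_lie_bracket pulled_S1 pulled_S2 _ => x.
by apply: ord5P => /=; ring.
Qed.

Lemma pulled_S5 : pulled (S5 kappa c) S5X.
Proof.
apply: pulled_lie_bracket pulled_S2 pulled_S3 _ => x.
by apply: ord5P => /=; ring.
Qed.

Lemma pulled_S6 : pulled (S6 kappa c) S6X.
Proof.
apply: pulled_lie_bracket pulled_S3 pulled_S1 _ => x.
by apply: ord5P => /=; ring.
Qed.

(** Omitted entries are 0. The first six matrices are multiples of the root vectors E_20, E_21,
    E_01, E_02, E_12, E_10; the last two span the diagonal Cartan subalgebra. *)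
Definition sl3_basis : seq ('M[R]_3) :=
  [:: mx3 [:: [::]; [::]; [:: - 6]]; mx3 [:: [::]; [::]; [:: 0; 6]];
      mx3 [:: [:: 0; 6]]; mx3 [:: [:: 0; 0; - 6]];
      mx3 [:: [::]; [:: 0; 0; 6]]; mx3 [:: [::]; [:: 6]];
      mx3 [:: [:: 2]; [:: 0; - 4]; [:: 0; 0; 2]];
      mx3 [:: [:: - 2]; [:: 0; - 2]; [:: 0; 0; 4]]].

Lemma pulled_sl3_basis k : (k < 8)%N ->
  pulled (nth (fun=> 0) [:: L1 kappa c; L2 kappa c; L3 kappa c; L4 kappa c;
           L5 kappa c; L6 kappa c; H1 kappa c; H2 kappa c] k)
         (sl3X (nth 0 sl3_basis k)).
Proof.
move: pulled_S1 pulled_S2 pulled_S3 pulled_S4 pulled_S5 pulled_S6.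
move=> s1 s2 s3 s4 s5 s6.
case: k => [|[|[|[|[|[|[|[|//]]]]]]]] _ /=.
- by apply: pulled_lie_bracket s1 s4 _ => x; apply: ord5P; rewrite /= !mxE/=; ring.
- by apply: pulled_lie_bracket s2 s4 _ => x; apply: ord5P; rewrite /= !mxE/=; ring.
- by apply: pulled_lie_bracket s2 s5 _ => x; apply: ord5P; rewrite /= !mxE/=; ring.
- by apply: pulled_lie_bracket s3 s5 _ => x; apply: ord5P; rewrite /= !mxE/=; ring.
- by apply: pulled_lie_bracket s3 s6 _ => x; apply: ord5P; rewrite /= !mxE/=; ring.
- by apply: pulled_lie_bracket s1 s6 _ => x; apply: ord5P; rewrite /= !mxE/=; ring.
- by apply: pulled_lie_bracket s2 s6 _ => x; apply: ord5P; rewrite /= !mxE/=; ring.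
- by apply: pulled_lie_bracket s4 s3 _ => x; apply: ord5P; rewrite /= !mxE/=; ring.
Qed.
End Fields.

(** * Restriction to c_3 = 0, extension across h = 0 and projection *)

Section Projection.
Context {R : realType}.
Variables (kappa c : R).
Hypothesis hc : c != 0.
Local Notation domM := (domM kappa c).
Local Notation pull := (pull kappa c).
Local Notation pulled := (pulled kappa c).
Local Notation hypersurface := (hypersurface kappa c).
Implicit Types (A B : 'M[R]_3) (X : 'rV[R]_5 -> 'rV[R]_5).

Local Notation y_ k := (Var (o_ 4 k)).
Local Notation z_ k := (Var (o_ 3 k)).

Definition hypersurfaceX : 'I_5 -> expr (R := R) 4 :=
  fld [:: y_ 0; y_ 1; y_ 2; Cst (- (kappa / (2 * c))) * y_ 3; y_ 3]%X.

Lemma hypersurfaceE : hypersurface = evalv hypersurfaceX.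
Proof.
apply/funext => y; apply/rowP; apply: ord5P; rewrite !mxE /=;
  rewrite ?(coordE (isT : 0 < 4)%N) ?(coordE (isT : 1 < 4)%N)
    ?(coordE (isT : 2 < 4)%N) ?(coordE (isT : 3 < 4)%N) //.
Qed.

Definition proj_hypersurfaceX : 'I_5 -> expr (R := R) 4 :=
  fld [:: y_ 0; y_ 1; Cst 0; Cst (- (kappa / (2 * c))) * y_ 3; y_ 3]%X.

Lemma proj_hypersurfaceE :
  Defs.proj kappa c \o hypersurface = evalv proj_hypersurfaceX.
Proof.
apply/funext => y; rewrite hypersurfaceE; apply/rowP; apply: ord5P;
  rewrite /= /Defs.proj /theta /phi /psi
    !(coordE (isT : 0 < 5)%N) !(coordE (isT : 1 < 5)%N) !(coordE (isT : 4 < 5)%N);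
  by rewrite !mxE /= ?mxE.
Qed.

Definition baseX : 'I_5 -> expr (R := R) 3 :=
  fld [:: z_ 0; z_ 1; Cst 0; Cst (- (kappa / (2 * c))) * z_ 2; z_ 2]%X.

Lemma baseE : base kappa c = evalv baseX.
Proof.
apply/funext => z; apply/rowP; apply: ord5P; rewrite !mxE /=;
  by rewrite ?(coordE (isT : 0 < 3)%N) ?(coordE (isT : 1 < 3)%N)
    ?(coordE (isT : 2 < 3)%N).
Qed.

(* The components [x4' / h] and [x5' / h] on [c_3 = 0] of the field of [A],
   where [x4 = - sin psi * h] and [x5 = cos psi * h]. *)
Definition fibre4 {n} A (x1 x2 ps : expr (R := R) n) : expr (R := R) n :=
  ((Cst (A (o_ 3 0) (o_ 3 2)) * x1 - Cst (A (o_ 3 0) (o_ 3 0))) * Sin ps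
   + (Cst (A (o_ 3 1) (o_ 3 2)) * x1 - Cst (A (o_ 3 1) (o_ 3 0))) * Cos ps)%X.
Definition fibre5 {n} A (x1 x2 ps : expr (R := R) n) : expr (R := R) n :=
  ((Cst (A (o_ 3 0) (o_ 3 1)) - Cst (A (o_ 3 0) (o_ 3 2)) * x2) * Sin ps
   + (Cst (A (o_ 3 1) (o_ 3 1)) - Cst (A (o_ 3 1) (o_ 3 2)) * x2) * Cos ps)%X.
(** With v = (x1, x2, 1), [plane1] and [plane2] are the first two components of v A - (v A)_3 v, the
    projective field of [A] in the affine chart. *)
Definition plane1 {n} A (x1 x2 : expr (R := R) n) : expr (R := R) n :=
  (Cst (A (o_ 3 2) (o_ 3 0))
   + Cst (A (o_ 3 0) (o_ 3 0) - A (o_ 3 2) (o_ 3 2)) * x1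
   + Cst (A (o_ 3 1) (o_ 3 0)) * x2
   - x1 * (Cst (A (o_ 3 0) (o_ 3 2)) * x1 + Cst (A (o_ 3 1) (o_ 3 2)) * x2))%X.
Definition plane2 {n} A (x1 x2 : expr (R := R) n) : expr (R := R) n :=
  (Cst (A (o_ 3 2) (o_ 3 1))
   + Cst (A (o_ 3 0) (o_ 3 1)) * x1
   + Cst (A (o_ 3 1) (o_ 3 1) - A (o_ 3 2) (o_ 3 2)) * x2
   - x2 * (Cst (A (o_ 3 0) (o_ 3 2)) * x1 + Cst (A (o_ 3 1) (o_ 3 2)) * x2))%X.

(** From x4 = - h sin psi and x5 = h cos psi one gets h' = x5' cos psi - x4' sin psi and h psi' = -
    (x4' cos psi + x5' sin psi). As x4' and x5' are h times [b4] and [b5], the factor 1 / h cancels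
    and h' vanishes at h = 0. *)
Definition extensionX A : 'I_4 -> expr (R := R) 4 :=
  let h := y_ 2 in let s := Sin (y_ 3) in let k := Cos (y_ 3) in
  let g := (Cst (3 * kappa * c ^+ 2) - h * h)%X in
  let x1 := (Cst (6 * c ^+ 3) * y_ 0 - h * g * k)%X in
  let x2 := (Cst (6 * c ^+ 3) * y_ 1 + h * g * s)%X in
  let b4 := fibre4 A x1 x2 (y_ 3) in let b5 := fibre5 A x1 x2 (y_ 3) in
  let u := Cst (6 * c ^+ 3)^-1 in
  fld [:: u * (plane1 A x1 x2 + h * b4 * (Cst 2 * h * h * s * k)
               + h * b5 * (g - Cst 2 * h * h * k * k));
          u * (plane2 A x1 x2 + h * b4 * (g - Cst 2 * h * h * s * s)
               + h * b5 * (Cst 2 * h * h * s * k));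
          h * (b5 * k - b4 * s); - (b4 * k + b5 * s)]%X.

(** The extension at h = 0: a projective field on the plane, and the motion it induces on the
    direction (sin psi, cos psi). *)
Definition baseFieldX A : 'I_3 -> expr (R := R) 3 :=
  let x1 := (Cst (6 * c ^+ 3) * z_ 0)%X in
  let x2 := (Cst (6 * c ^+ 3) * z_ 1)%X in
  let u := Cst (6 * c ^+ 3)^-1 in
  fld [:: u * plane1 A x1 x2; u * plane2 A x1 x2;
          - (fibre4 A x1 x2 (z_ 2) * Cos (z_ 2)
             + fibre5 A x1 x2 (z_ 2) * Sin (z_ 2))]%X.

Lemma hh_hypersurface (y : 'rV[R]_4) : hh (hypersurface y) = y ord0 (o_ 4 2).
Proof. by rewrite hhE hypersurfaceE mxE. Qed.

Lemma derive_hypersurface_extension A (y : 'rV[R]_4) :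
  y ord0 (o_ 4 2) != 0 ->
  'D_(evalv (extensionX A) y) hypersurface y = pull (sl3X A) (hypersurface y).
Proof.
move=> hy; have c3n : 6 * c ^+ 3 != 0 :> R.
  by rewrite mulf_neq0 ?expf_neq0 ?pnatr_eq0.
rewrite /pull /frame hh_hypersurface.
(* Here q = - kappa psi / (2 c), so c_3 = 0 and its terms drop from c_1 and c_2. *)
have -> : cmap kappa c (hypersurface y) = evalv (fld
    [:: Cst (6 * c ^+ 3) * y_ 0
          - y_ 2 * (Cst (3 * kappa * c ^+ 2) - y_ 2 * y_ 2) * Cos (y_ 3);
        Cst (6 * c ^+ 3) * y_ 1
          + y_ 2 * (Cst (3 * kappa * c ^+ 2) - y_ 2 * y_ 2) * Sin (y_ 3);
        Cst 0; - Sin (y_ 3) * y_ 2; Cos (y_ 3) * y_ 2]%X) y.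
  rewrite cmapE hypersurfaceE; apply/rowP.
  by apply: ord5P; rewrite !mxE /= !mxE /=; field.
rewrite hypersurfaceE derive_evalv; apply/rowP.
apply: ord5P; rewrite sum_ord5 /= !mxE /= !mxE /=;
  by field; rewrite ?hc ?hy.
Qed.

Lemma derive_base_field A (z : 'rV[R]_3) :
  'D_(evalv (baseFieldX A) z) (base kappa c) z =
  'D_(evalv (extensionX A) (zero_section z)) (Defs.proj kappa c \o hypersurface)
     (zero_section z).
Proof.
have -> : zero_section z = evalv (fld [:: z_ 0; z_ 1; Cst 0; z_ 2]) z.
  apply/rowP; apply: ord4P; rewrite !mxE /=;
  by rewrite ?(coordE (isT : 0 < 3)%N) ?(coordE (isT : 1 < 3)%N)
    ?(coordE (isT : 2 < 3)%N).
rewrite proj_hypersurfaceE baseE !derive_evalv; apply/rowP.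
by apply: ord5P; rewrite !mxE /= ?mxE /= ?mxE /=; ring.
Qed.

Lemma c3E : c3 kappa c = evalx (cmapX kappa c (o_ 5 2)).
Proof.
apply/funext => p; transitivity (cmap kappa c p ord0 (o_ 5 2)).
  by rewrite mxE.
by rewrite cmapE mxE.
Qed.

(** Every term of the c_3 component of [sl3X A] contains the factor c_3. *)
Lemma derive_c3_pull A p : hh p != 0 -> c3 kappa c p = 0 ->
  'D_(pull (sl3X A) p) (c3 kappa c) p = 0.
Proof.
move=> hp p0; have := derive_cmap_pull kappa c hc (sl3X A) p hp.
rewrite {1}cmapE derive_evalv => /rowP/(_ (o_ 5 2)).
rewrite [LHS]mxE -derive_eval -c3E => ->.
by rewrite !mxE /= !mxE /= p0; ring.
Qed.

Lemma baseField_periodic A (t f s : R) :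
  evalv (baseFieldX A) (vec 3 [:: t; f; s + 2 * pi]) =
  evalv (baseFieldX A) (vec 3 [:: t; f; s]).
Proof.
have e2 : 2 * pi = pi *+ 2 :> R by rewrite mulr_natl.
by apply/rowP; apply: ord3P; rewrite !mxE /= !mxE /= ?e2 ?sinD2pi ?cosD2pi.
Qed.

Lemma projects_pulled A X : pulled X (sl3X A) ->
  projects_to kappa c X (evalv (baseFieldX A)).
Proof.
move=> XA; split.
- move=> p dp p0; rewrite XA//; apply: derive_c3_pull => //.
  exact: domM_hh_neq0 dp.
- split; [exact: smooth_evalv | exact: baseField_periodic].
- exists (evalv (extensionX A)); split.
  + exact: smooth_evalv.
  + move=> y dy; rewrite XA//; apply: derive_hypersurface_extension.
    by rewrite -hh_hypersurface; exact: domM_hh_neq0 dy.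
  + move=> y; rewrite !(coordE (isT : 2 < 4)%N) mxE /= => ->; exact: mul0r.
  + exact: derive_base_field.
Qed.

Lemma derive_hypersurface_inj (y v w : 'rV[R]_4) :
  'D_v hypersurface y = 'D_w hypersurface y -> v = w.
Proof.
rewrite hypersurfaceE !derive_evalv => /rowP e; apply/rowP.
by apply: ord4P; [have := e (o_ 5 0) | have := e (o_ 5 1) | have := e (o_ 5 2)
  | have := e (o_ 5 4)]; rewrite !mxE.
Qed.

Lemma derive_base_inj (z v w : 'rV[R]_3) :
  'D_v (base kappa c) z = 'D_w (base kappa c) z -> v = w.
Proof.
rewrite baseE !derive_evalv => /rowP e; apply/rowP.
by apply: ord3P; [have := e (o_ 5 0) | have := e (o_ 5 1) | have := e (o_ 5 4)];
  rewrite !mxE.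
Qed.

(* The points of the hypersurface in [domM] accumulate at [h = 0]. *)
Lemma extension_unique (Y Y' : 'rV[R]_4 -> 'rV[R]_4) z :
  continuous Y -> continuous Y' ->
  (forall y, domM (hypersurface y) -> Y y = Y' y) ->
  Y (zero_section z) = Y' (zero_section z).
Proof.
move=> cY cY' YY'; apply/eqP; rewrite -subr_eq0; apply/negPn/negP => n0.
(* The line [l] leaves the zero section in the h direction. *)
pose l (t : R) : 'rV[R]_4 := zero_section z + t *: delta_mx ord0 (o_ 4 2).
have l0 : l 0 = zero_section z by rewrite /l scale0r addr0.
have lc : {for 0, continuous l}.
  apply: cvgD; first exact: cvg_cst.
  by apply: cvgZr_tmp; exact: cvg_id.
have dc : {for 0, continuous (fun t => Y (l t) - Y' (l t))}.
  by apply: cvgB; apply: continuous_comp => //; [exact: cY | exact: cY'].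
have nz : \forall t \near (0 : R), Y (l t) - Y' (l t) != 0.
  by apply: cvgr_neq0 dc _; rewrite l0.
have nd : \forall t \near (0 : R)^'+, domM (hypersurface (l t)).
  have hl t : hh (hypersurface (l t)) = t.
    by rewrite hh_hypersurface /l /zero_section !mxE /= mulr1 add0r.
  (* The only positive h with h^2 = kappa c^2 can be this root. Small t > 0 stay below it if it is
     positive, and above it otherwise. *)
  have nr : \forall t \near (0 : R)^'+, t != Num.sqrt (kappa * c ^+ 2).
    have [r0|r0] := ltP 0 (Num.sqrt (kappa * c ^+ 2)); near=> t.
      by rewrite lt_eqF//; near: t; exact: nbhs_right_lt.
    by rewrite gt_eqF// (le_lt_trans r0)//; near: t; exact: nbhs_right_gt.
  near=> t; have t0 : 0 < t by near: t; exact: nbhs_right_gt.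
  split; rewrite hl//; apply/negP => /eqP tk.
  suff /eqP : t != Num.sqrt (kappa * c ^+ 2).
    by rewrite -tk sqrtr_sqr gtr0_norm.
  by near: t.
(* Just to the right of 0 the difference would be both zero and nonzero, while that filter is
   proper. *)
have : \forall t \near (0 : R)^'+, False.
  near=> t.
  have : Y (l t) - Y' (l t) != 0 by near: t; exact: cvg_within nz.
  by rewrite YY' ?subrr ?eqxx//; near: t.
by move/filter_ex => [].
Unshelve. all: by end_near. Qed.

(** Injectivity of the differential of [hypersurface] fixes the extension on the domain, continuity
    fixes it at h = 0, and injectivity of the differential of [base] then fixes the projected
    field. *)
Lemma projects_to_unique X W W' : projects_to kappa c X W ->
  projects_to kappa c X W' -> W = W'.
Proof.
move=> [_ _ [Y [sY hY _ bY]]] [_ _ [Y' [sY' hY' _ bY']]].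
apply/funext => z; apply: (derive_base_inj z); rewrite bY bY'.
(* Smoothness at order 0 is continuity. *)
rewrite (extension_unique Y Y' z (sY 0%N) (sY' 0%N))// => y dy.
by apply: (derive_hypersurface_inj y); rewrite hY// hY'.
Qed.

Lemma baseField_linear (a : R) A B :
  evalv (baseFieldX (a *: A + B)) =
  (fun z => a *: evalv (baseFieldX A) z + evalv (baseFieldX B) z).
Proof.
by apply/funext => z; apply/rowP; apply: ord3P; rewrite !mxE /= !mxE; ring.
Qed.

Lemma baseField_commutator A B : \tr A = 0 -> \tr B = 0 ->
  evalv (baseFieldX (A *m B - B *m A)) =
  lie_bracket (evalv (baseFieldX A)) (evalv (baseFieldX B)).
Proof.
move=> /trace0E tA /trace0E tB; rewrite lie_bracket_evalv.
have c3n : 6 * c ^+ 3 != 0 :> R by rewrite mulf_neq0 ?expf_neq0 ?pnatr_eq0.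
apply/funext => z; apply/rowP; apply: ord3P;
  rewrite !mxE /= !mxE !sum_ord3 tA tB.
- by field; rewrite ?hc.
- by field; rewrite ?hc.
- set ps := z ord0 (o_ 3 2).
  pose x1 := 6 * c ^+ 3 * z ord0 (o_ 3 0).
  pose x2 := 6 * c ^+ 3 * z ord0 (o_ 3 1).
  (* The psi component of the field of [M] is a sin cos + b cos^2 - g sin^2. The bracket contains
     terms of degree four in sin and cos, brought to degree two by the cofactor below. *)
  pose a (M : 'M[R]_3) := M (o_ 3 0) (o_ 3 0) - M (o_ 3 0) (o_ 3 2) * x1
                         - M (o_ 3 1) (o_ 3 1) + M (o_ 3 1) (o_ 3 2) * x2.
  pose b (M : 'M[R]_3) := M (o_ 3 1) (o_ 3 0) - M (o_ 3 1) (o_ 3 2) * x1.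
  pose g (M : 'M[R]_3) := M (o_ 3 0) (o_ 3 1) - M (o_ 3 0) (o_ 3 2) * x2.
  apply/esym; apply: (@trig_eq _ ps (- ((a A * b B - a B * b A) * cos ps ^+ 2
    + (a A * g B - a B * g A) * sin ps ^+ 2
    + 2 * (b A * g B - b B * g A) * sin ps * cos ps))).
  by rewrite /a /b /g /x1 /x2; field; rewrite ?hc.
Qed.

End Projection.

(** * Inclusion of the span in the Lie algebra generated by S^1, S^2, S^3 *)

Lemma sl3_sub_g2 (R : realType) (kappa c : R) : sl3 kappa c `<=` g2 kappa c.
Proof.
move=> X [a Xa] T [[text t0 tlin tbr] tS].
have s1 : T (S1 kappa c) by apply: tS; left; left.
have s2 : T (S2 kappa c) by apply: tS; left; right.
have s3 : T (S3 kappa c) by apply: tS; right.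
have [s4 s5 s6] : [/\ T (S4 kappa c), T (S5 kappa c) & T (S6 kappa c)].
  by split; exact: tbr.
pose s := [:: L1 kappa c; L2 kappa c; L3 kappa c; L4 kappa c; L5 kappa c;
  L6 kappa c; H1 kappa c; H2 kappa c].
(* From index 8 on, [nth] returns the zero field, which also lies in [T]. *)
have Ts i : T (nth (fun=> 0) s i).
  by move: i => [|[|[|[|[|[|[|[|i]]]]]]]]; rewrite /= ?nth_nil; do 1?[exact: tbr].
suff Tn n : T (fun p => \sum_(i < n) a i *: nth (fun=> 0) s i p).
  by apply: text (Tn 8%N) => p dp; rewrite Xa.
elim: n => [|n IH].
  by apply: text t0 => p _; rewrite big_ord0.
apply: text (tlin (a n) _ _ (Ts n) IH) => p _.
by rewrite big_ord_recr /= addrC.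
Qed.

(** * The span as the image of the traceless matrices, and the conclusion *)

Section Assembly.
Context {R : realType}.
Variables (kappa c : R).
Hypothesis hc : c != 0.

Lemma pull_sl3X_sum n (a : nat -> R) (B : nat -> 'M[R]_3) p :
  pull kappa c (sl3X (\sum_(i < n) a i *: B i)) p =
  \sum_(i < n) a i *: pull kappa c (sl3X (B i)) p.
Proof.
elim: n => [|n IH]; last by rewrite !big_ord_recr /= addrC pull_sl3X_linear IH addrC.
(* Linearity with coefficient -1 at zero matrices shows that the zero matrix gives the zero
   field. *)
rewrite !big_ord0; have := pull_sl3X_linear kappa c (-1) 0 0 p.
by rewrite scaler0 addr0 scaleN1r addNr.
Qed.

Lemma trace_mx3 s : \tr (mx3 s) =
  nth 0 (nth [::] s 0) 0 + nth 0 (nth [::] s 1) 1 + nth 0 (nth [::] s 2) 2 :> R.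
Proof. by rewrite /mxtrace sum_ord3 !mxE. Qed.

Lemma sl3_basis_span (A : 'M[R]_3) : \tr A = 0 -> exists a : nat -> R,
  A = \sum_(i < 8) a i *: nth 0 sl3_basis i.
Proof.
move=> /trace0E tA.
(* The coefficients x and y of H_1 and H_2 solve 2 x - 2 y = A_00 and - 4 x - 2 y = A_11; [d] is x,
   and y is [d] - A_00 / 2. *)
pose d := (A (o_ 3 0) (o_ 3 0) - A (o_ 3 1) (o_ 3 1)) / 6.
exists (nth 0 [:: - A (o_ 3 2) (o_ 3 0) / 6; A (o_ 3 2) (o_ 3 1) / 6;
  A (o_ 3 0) (o_ 3 1) / 6; - A (o_ 3 0) (o_ 3 2) / 6; A (o_ 3 1) (o_ 3 2) / 6;
  A (o_ 3 1) (o_ 3 0) / 6; d; d - A (o_ 3 0) (o_ 3 0) / 2]).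
apply/matrixP; rewrite /d !big_ord_recl big_ord0 /=.
by apply: ord3P; apply: ord3P; rewrite !mxE /= ?tA; field.
Qed.

(** The matrices of [sl3_basis] are traceless and span the traceless matrices, so questions about
    the span become matrix algebra. *)
Lemma sl3P X : sl3 kappa c X <->
  exists2 A : 'M[R]_3, \tr A = 0 & pulled kappa c X (sl3X A).
Proof.
split=> [[a Xa]|[A tA XA]].
- exists (\sum_(i < 8) a i *: nth 0 sl3_basis i).
    rewrite raddf_sum big1//= => i _; rewrite mxtraceZ.
    suff -> : \tr (nth 0 sl3_basis i : 'M[R]_3) = 0 by rewrite mulr0.
    by case: i => [[|[|[|[|[|[|[|[|//]]]]]]]] /= _]; rewrite trace_mx3 /=; ring.
  move=> p dp; rewrite Xa// pull_sl3X_sum; apply: eq_bigr => i _.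
  by rewrite (pulled_sl3_basis kappa c hc _ (ltn_ord i) p dp).
- have [a Aa] := sl3_basis_span A tA; exists a => p dp.
  rewrite XA// [in LHS]Aa pull_sl3X_sum; apply: eq_bigr => i _.
  by rewrite (pulled_sl3_basis kappa c hc _ (ltn_ord i) p dp).
Qed.

Lemma trace0_linear (a : R) (A B : 'M[R]_3) :
  \tr A = 0 -> \tr B = 0 -> \tr (a *: A + B) = 0.
Proof. by move=> tA tB; rewrite mxtraceD mxtraceZ tA tB mulr0 addr0. Qed.

Lemma trace0_commutator (A B : 'M[R]_3) : \tr (A *m B - B *m A) = 0.
Proof. by rewrite raddfB /= mxtrace_mulC subrr. Qed.

Lemma pulled_sl3X_linear (a : R) X X' A B :
  pulled kappa c X (sl3X A) -> pulled kappa c X' (sl3X B) ->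
  pulled kappa c (fun p => a *: X p + X' p) (sl3X (a *: A + B)).
Proof. by move=> XA XB p dp; rewrite pull_sl3X_linear XA// XB. Qed.

Lemma pulled_sl3X_bracket X X' (A B : 'M[R]_3) : \tr A = 0 -> \tr B = 0 ->
  pulled kappa c X (sl3X A) -> pulled kappa c X' (sl3X B) ->
  pulled kappa c (lie_bracket X X') (sl3X (A *m B - B *m A)).
Proof.
move=> tA tB XA XB; apply: (pulled_lie_bracket _ _ hc _ _ _ _ _ XA XB) => x i.
exact: brk_sl3X.
Qed.

Lemma sl3_lie_algebra : lie_algebra_on (domM kappa c) (sl3 kappa c).
Proof.
split.
- move=> X Y XY [a Xa]; exists a => p dp; rewrite -XY//; exact: Xa.
- by exists (fun=> 0) => p _; rewrite big1// => i _; rewrite scale0r.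
- move=> a X Y /sl3P [A tA XA] /sl3P [B tB YB]; apply/sl3P.
  by exists (a *: A + B); [exact: trace0_linear | exact: pulled_sl3X_linear].
- move=> X Y /sl3P [A tA XA] /sl3P [B tB YB]; apply/sl3P.
  exists (A *m B - B *m A); first exact: trace0_commutator.
  exact: pulled_sl3X_bracket.
Qed.

End Assembly.

Theorem theorem4p1 (R : realType) (kappa c : R) (hc : c != 0) :
  [/\ sl3 kappa c `<=` g2 kappa c,
      lie_algebra_on (domM kappa c) (sl3 kappa c),
      forall X, sl3 kappa c X -> exists! W, projects_to kappa c X W,
      forall X X' W W', sl3 kappa c X -> sl3 kappa c X' ->
        projects_to kappa c X W -> projects_to kappa c X' W' ->
        (forall a : R, projects_to kappa c (fun p => a *: X p + X' p)
                                           (fun z => a *: W z + W' z)) /\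
        projects_to kappa c (lie_bracket X X') (lie_bracket W W')
    & sl3_action_image (projected_sl3 kappa c)].
Proof.
split.
- exact: sl3_sub_g2.
- exact: sl3_lie_algebra.
- move=> X /(sl3P _ _ hc) [A tA XA]; exists (evalv (baseFieldX c A)); split.
    exact: projects_pulled.
  by move=> W; apply: projects_to_unique; exact: projects_pulled.
- move=> X X' W W' /(sl3P _ _ hc) [A tA XA] /(sl3P _ _ hc) [B tB XB] XW XW'.
  (* By uniqueness [W] and [W'] are the explicit fields of [A] and [B], for which both closure
     properties have been computed. *)
  have WA := projects_to_unique _ _ _ _ _ XW (projects_pulled _ _ hc _ _ XA).
  have WB := projects_to_unique _ _ _ _ _ XW' (projects_pulled _ _ hc _ _ XB).
  rewrite WA WB; split=> [a|].
    rewrite -baseField_linear; apply: projects_pulled => //.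
    exact: pulled_sl3X_linear.
  rewrite -(baseField_commutator _ hc _ _ tA tB); apply: projects_pulled => //.
  exact: pulled_sl3X_bracket.
- exists (fun A => evalv (baseFieldX c A)); split.
  + move=> a A B _ _; exact: baseField_linear.
  + move=> A B; exact: baseField_commutator.
  + apply/seteqP; split=> [W [X /(sl3P _ _ hc) [A tA XA] XW]|_ [A tA <-]].
      exists A => //.
      exact: projects_to_unique (projects_pulled _ _ hc _ _ XA) XW.
    (* Conversely, each traceless [A] is realised by its own pullback, an element of the span. *)
    exists (pull kappa c (sl3X A)); last exact: projects_pulled.
    by apply/(sl3P _ _ hc); exists A.
Qed.
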